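(* Let $\kappa\ge1$ be an integer, let $\mathbb{E}$ be a vector lattice with property $D$ and let $\mathbb{F}$ be an ordered vector space with property $C$. Let two tuples of interval operators $\boldsymbol{A}_\forall=\langle \boldsymbol{A}_1',\dots,\boldsymbol{A}_\kappa'\rangle$, $\boldsymbol{A}_\exists=\langle \boldsymbol{A}_1'',\dots,\boldsymbol{A}_\kappa''\rangle$ with $\boldsymbol{A}_i',\boldsymbol{A}_i''\in\mathbb{IL}(\mathbb{E},\mathbb{F})$ and two tuples of intervals $\boldsymbol{b}_\forall=\langle \boldsymbol{b}_1',\dots,\boldsymbol{b}_\kappa'\rangle$, $\boldsymbol{b}_\exists=\langle \boldsymbol{b}_1'',\dots,\boldsymbol{b}_\kappa''\rangle$ with $\boldsymbol{b}_i',\boldsymbol{b}_i''\in\mathbb{IF}$ be given ($i=1,\dots,\kappa$), written in centrally symmetric form $$\boldsymbol{A}_i'=[\check A_i'-\Delta_i',\check A_i'+\Delta_i'],\quad \boldsymbol{A}_i''=[\check A_i''-\Delta_i'',\check A_i''+\Delta_i''],\quad \boldsymbol{b}_i'=[\check b_i'-\delta_i',\check b_i'+\delta_i'],\quad \boldsymbol{b}_i''=[\check b_i''-\delta_i'',\check b_i''+\delta_i''].$$ Then $x\in\Xi_{iq}^{\kappa}(\boldsymbol{A}_\forall,\boldsymbol{A}_\exists,\boldsymbol{b}_\forall,\boldsymbol{b}_\exists)$ if and only if both of the following hold: $$-\sum_{i=1}^{\kappa}(\Delta_i''|x|+\delta_i'')+\sum_{i=1}^{\kappa}(\Delta_i'|x|+\delta_i')\le\sum_{i=1}^{\kappa}\left((\check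 A_i'+\check A_i'')x-(\check b_i'+\check b_i'')\right)\le\sum_{i=1}^{\kappa}(\Delta_i''|x|+\delta_i'')-\sum_{i=1}^{\kappa}(\Delta_i'|x|+\delta_i'),$$ $$\sum_{i=1}^{l}(\Delta_i'|x|+\delta_i')\le\sum_{i=1}^{l}(\Delta_i''|x|+\delta_i''),\qquad l=1,\dots,\kappa-1.$$
   Context: For an ordered vector space $\mathbb{F}$ over $\mathbb{R}$ with positive cone $\mathbb{F}_+$, an interval in $\mathbb{F}$ is a set $[\underline a,\overline a]=\{x\in\mathbb{F}\mid \underline a\le x\le\overline a\}$ with $\underline a\le\overline a$; $\mathbb{IF}$ is the set of all intervals in $\mathbb{F}$. $\mathbb{L}(\mathbb{E},\mathbb{F})$ is the space of linear operators from $\mathbb{E}$ to $\mathbb{F}$ ordered by the cone of positive operators ($A\le B$ iff $Ax\le Bx$ for all $x\ge0$ in $\mathbb{E}$; this is an order when $\mathbb{E}$ is a vector lattice), and $\mathbb{IL}(\mathbb{E},\mathbb{F})$ is the set of intervals in it (interval operators). In the centrally symmetric form of $[\underline b,\overline b]$ one has $\check b=\frac12(\overline b+\underline b)$, $\delta=\frac12(\overline b-\underline b)\ge0$; for $[\underline A,\overline A]$, $\check A=\frac12(\overline A+\underline A)$, $\Delta=\frac12(\overline A-\underline A)\ge0$. In a vector lattice, $|x|=x\vee(-x)$. A multiplicator in an ordered vector space $\mathbb{G}$ is a linear operator $\tau:\mathbb{G}\to\mathbb{G}$ with $0\le\tau\le I$ ($I$ the identity), i.e. $0\le\tau x\le x$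 for all $x\ge 0$. Property $C$: an ordered vector space $\mathbb{F}$ has property $C$ if for all $x,y\in\mathbb{F}_+$ with $x\le y$ there is a multiplicator $\tau$ in $\mathbb{F}$ with $\tau y=x$. Property $D$: a vector lattice $\mathbb{E}$ has property $D$ if for all $x,y\in\mathbb{E}_+$ with $x\wedge y=0$ there is a multiplicator $\zeta$ in $\mathbb{E}$ with $\zeta x=x$ and $\zeta y=0$. The solution set is $$\Xi_{iq}^{\kappa}(\boldsymbol{A}_\forall,\boldsymbol{A}_\exists,\boldsymbol{b}_\forall,\boldsymbol{b}_\exists)=\Big\{x\in\mathbb{E}\ \Big|\ (\forall A_\kappa'\in\boldsymbol{A}_\kappa')(\forall b_\kappa'\in\boldsymbol{b}_\kappa')(\exists A_\kappa''\in\boldsymbol{A}_\kappa'')(\exists b_\kappa''\in\boldsymbol{b}_\kappa'')\cdots(\forall A_1'\in\boldsymbol{A}_1')(\forall b_1'\in\boldsymbol{b}_1')(\exists A_1''\in\boldsymbol{A}_1'')(\exists b_1''\in\boldsymbol{b}_1'')\ \sum_{s=1}^{\kappa}(A_s'+A_s'')x=\sum_{s=1}^{\kappa}(b_s'+b_s'')\Big\},$$ where the quantifier blocks appear in order of decreasing index $\kappa,\kappa-1,\dots,1$ (block $\kappa$ outermost). *)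

(* Defs.v *)
From HB Require Import structures.
From mathcomp Require Import all_boot all_order all_algebra.
From mathcomp Require Import all_classical all_reals.

Set Implicit Arguments.
Unset Strict Implicit.
Unset Printing Implicit Defensive.

Import Order.TTheory GRing.Theory Num.Theory.

Local Open Scope classical_set_scope.
Local Open Scope ring_scope.

(* No generating or Archimedean assumption is made on the positive cone
   [set x | 0 <= x]. *)
HB.mixin Record isOrderedVect (R : realType) V
    of GRing.Lmodule R V & Order.POrder ring_display V := {
  levD2r : forall z x y : V, x <= y -> x + z <= y + z;
  lev_wpZ2l : forall (a : R) (x y : V), 0 <= a -> x <= y -> a *: x <= a *: y
}.

#[short(type="ordVectType")]
HB.structure Definition OrderedVect (R : realType) :=
  { V of GRing.Lmodule R V & Order.POrder ring_display V & isOrderedVect R V }.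

(* The binary infimum and supremum, with the axioms of [Order.Lattice].  That
   structure cannot itself be joined with [OrderedVect]: Hierarchy Builder would
   require [Num.RealDomain] to inherit from the result. *)
HB.mixin Record OrderedVect_isLattice (R : realType) V of OrderedVect R V := {
  vmeet : V -> V -> V;
  vjoin : V -> V -> V;
  lev_meet : forall x y z : V, (x <= vmeet y z) = (x <= y) && (x <= z);
  lev_join : forall x y z : V, (vjoin x y <= z) = (x <= z) && (y <= z)
}.

#[short(type="vectLatticeType")]
HB.structure Definition VectLattice (R : realType) :=
  { V of OrderedVect R V & OrderedVect_isLattice R V }.

Definition vabs (R : realType) (E : vectLatticeType R) (x : E) : E :=
  vjoin x (- x).

Section OrderedVectTheory.
Context (R : realType).

Lemma vsubr_ge0 (V : ordVectType R) (x y : V) : (0 <= y - x) = (x <= y).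
Proof.
by apply/idP/idP => [/(levD2r x)|/(levD2r (- x))]; rewrite ?add0r ?subrK ?subrr.
Qed.

Lemma vect_pos_diff (E : vectLatticeType R) (x : E) :
  exists p q : E, [/\ 0 <= p, 0 <= q & x = p - q].
Proof.
have := lev_join x 0 (vjoin x 0); rewrite lexx => /esym/andP[xj j0].
by exists (vjoin x 0), (vjoin x 0 - x); rewrite vsubr_ge0 subKr.
Qed.

End OrderedVectTheory.

Section LinearLmodule.
Context (R : realType) (E F : lmodType R).
Implicit Types A B C : {linear E -> F}.

Definition lin_add A B : {linear E -> F} := A \+ B.
Definition lin_opp A : {linear E -> F} := \- A.
Definition lin_zero : {linear E -> F} := \0.
Definition lin_scale (a : R) A : {linear E -> F} := a \*: A.

Let lin_ext A B : A =1 B -> A = B.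
Proof.
move: A B => [f [[f1] [f2]]] [g [[g1] [g2]]] /= /funext fg.
rewrite fg in f1 f2 *.
by rewrite (Prop_irrelevance f1 g1) (Prop_irrelevance f2 g2).
Qed.

Let lin_addA : associative lin_add.
Proof. by move=> A B C; apply: lin_ext => x /=; rewrite addrA. Qed.
Let lin_addC : commutative lin_add.
Proof. by move=> A B; apply: lin_ext => x /=; rewrite addrC. Qed.
Let lin_add0 : left_id lin_zero lin_add.
Proof. by move=> A; apply: lin_ext => x /=; rewrite add0r. Qed.
Let lin_addN : left_inverse lin_zero lin_opp lin_add.
Proof. by move=> A; apply: lin_ext => x /=; rewrite addNr. Qed.

HB.instance Definition _ := GRing.isZmodule.Build {linear E -> F}
  lin_addA lin_addC lin_add0 lin_addN.

Let lin_scaleA (a b : R) A : lin_scale a (lin_scale b A) = lin_scale (a * b) A.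
Proof. by apply: lin_ext => x /=; rewrite scalerA. Qed.
Let lin_scale1 : left_id 1 lin_scale.
Proof. by move=> A; apply: lin_ext => x /=; rewrite scale1r. Qed.
Let lin_scaleDr : right_distributive lin_scale +%R.
Proof. by move=> a A B; apply: lin_ext => x /=; rewrite scalerDr. Qed.
Let lin_scaleDl A : {morph lin_scale^~ A : a b / a + b}.
Proof. by move=> a b; apply: lin_ext => x /=; rewrite scalerDl. Qed.

HB.instance Definition _ := GRing.Zmodule_isLmodule.Build R {linear E -> F}
  lin_scaleA lin_scale1 lin_scaleDr lin_scaleDl.

Lemma linP A B : A =1 B <-> A = B.
Proof. by split=> [/lin_ext|->]. Qed.
Lemma linD A B x : (A + B) x = A x + B x. Proof. by []. Qed.
Lemma linN A x : (- A) x = - A x. Proof. by []. Qed.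
Lemma lin0 x : (0 : {linear E -> F}) x = 0. Proof. by []. Qed.
Lemma linZ (a : R) A x : (a *: A) x = a *: A x. Proof. by []. Qed.

End LinearLmodule.

(* The order of L(E, F) given by the cone of positive operators; antisymmetry
   is where E must be a vector lattice. *)
Section LinearOrder.
Context (R : realType) (E : vectLatticeType R) (F : ordVectType R).
Implicit Types A B C : {linear E -> F}.

Definition lin_le A B : bool := `[< forall x : E, 0 <= x -> A x <= B x >].

Let lin_le_refl : reflexive lin_le.
Proof. by move=> A; apply/asboolP. Qed.
Let lin_le_anti : antisymmetric lin_le.
Proof.
move=> A B /andP[/asboolP AB /asboolP BA]; apply/linP => x.
have [p [q [p0 q0 ->]]] := vect_pos_diff x.
have eqAB y : 0 <= y -> A y = B y.
  by move=> y0; apply/eqP; rewrite eq_le AB// BA.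
by rewrite !linearB !eqAB.
Qed.
Let lin_le_trans : transitive lin_le.
Proof.
move=> B A C /asboolP AB /asboolP BC; apply/asboolP => x x0.
exact: le_trans (AB x x0) (BC x x0).
Qed.

HB.instance Definition _ := Order.Le_isPOrder.Build ring_display
  {linear E -> F} lin_le_refl lin_le_anti lin_le_trans.

Lemma lin_leP A B : reflect (forall x : E, 0 <= x -> A x <= B x) (A <= B).
Proof. exact: asboolP. Qed.

Let lin_levD2r C A B : A <= B -> A + C <= B + C.
Proof. by move=> /lin_leP AB; apply/lin_leP => x /AB; exact: levD2r. Qed.
Let lin_lev_wpZ2l (a : R) A B : 0 <= a -> A <= B -> a *: A <= a *: B.
Proof.
by move=> a0 /lin_leP AB; apply/lin_leP => x /AB; exact: lev_wpZ2l.
Qed.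

HB.instance Definition _ := isOrderedVect.Build R {linear E -> F}
  lin_levD2r lin_lev_wpZ2l.

End LinearOrder.

Definition multiplicator (R : realType) (G : ordVectType R)
    (t : {linear G -> G}) : Prop :=
  forall x : G, 0 <= x -> 0 <= t x <= x.

Definition propertyC (R : realType) (F : ordVectType R) : Prop :=
  forall x y : F, 0 <= x -> 0 <= y -> x <= y ->
  exists t : {linear F -> F}, multiplicator t /\ t y = x.

Definition propertyD (R : realType) (E : vectLatticeType R) : Prop :=
  forall x y : E, 0 <= x -> 0 <= y -> vmeet x y = 0 ->
  exists z : {linear E -> E}, [/\ multiplicator z, z x = x & z y = 0].

Record ivl (R : realType) (G : ordVectType R) : Type := Ivl {
  ivl_lo : G;
  ivl_hi : G;
  ivl_le : ivl_lo <= ivl_hi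
}.

Definition ivl_set (R : realType) (G : ordVectType R) (a : ivl G) : set G :=
  [set x | ivl_lo a <= x <= ivl_hi a].

Definition ivl_mid (R : realType) (G : ordVectType R) (a : ivl G) : G :=
  2%:R^-1 *: (ivl_hi a + ivl_lo a).

Definition ivl_rad (R : realType) (G : ordVectType R) (a : ivl G) : G :=
  2%:R^-1 *: (ivl_hi a - ivl_lo a).

Definition ivlop (R : realType) (E : vectLatticeType R) (F : ordVectType R) :=
  ivl {linear E -> F}.

Definition ord_snoc (T : Type) (n : nat) (f : 'I_n -> T) (t : T) :
    'I_n.+1 -> T :=
  fun i => oapp f t (unlift ord_max i).

(* The quantifier prefix over n blocks applied to the matrix P, which receives
   the four tuples of chosen elements.  The index i : 'I_n stands for the
   (i+1)-st block, so the outermost block is that of ord_max.  At n = 0 the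
   tuples are empty and [fun=> 0] is a vacuous filler. *)
Fixpoint quant_blocks (R : realType) (E : vectLatticeType R)
    (F : ordVectType R) (n : nat) :
    ('I_n -> ivlop E F) -> ('I_n -> ivlop E F) ->
    ('I_n -> ivl F) -> ('I_n -> ivl F) ->
    (('I_n -> {linear E -> F}) -> ('I_n -> {linear E -> F}) ->
     ('I_n -> F) -> ('I_n -> F) -> Prop) -> Prop :=
  match n with
  | 0 => fun _ _ _ _ P =>
      P (fun=> 0) (fun=> 0) (fun=> 0) (fun=> 0)
  | n'.+1 => fun AA AE bA bE P =>
      let init (T : Type) (f : 'I_n'.+1 -> T) := fun i => f (lift ord_max i) in
      forall A' : {linear E -> F}, ivl_set (AA ord_max) A' ->
      forall b' : F, ivl_set (bA ord_max) b' ->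
      exists2 A'' : {linear E -> F}, ivl_set (AE ord_max) A'' &
      exists2 b'' : F, ivl_set (bE ord_max) b'' &
      quant_blocks (init _ AA) (init _ AE) (init _ bA) (init _ bE)
        (fun As' As'' bs' bs'' =>
           P (ord_snoc As' A') (ord_snoc As'' A'')
             (ord_snoc bs' b') (ord_snoc bs'' b''))
  end.

Definition Xi_iq (R : realType) (E : vectLatticeType R) (F : ordVectType R)
    (k : nat) (AA AE : 'I_k -> ivlop E F) (bA bE : 'I_k -> ivl F) : set E :=
  [set x | quant_blocks AA AE bA bE (fun A' A'' b' b'' =>
     \sum_(s < k) (A' s + A'' s) x = \sum_(s < k) (b' s + b'' s))].

(* Main.v *)
Require Import Defs.
From mathcomp Require Import all_boot all_order all_algebra.
From mathcomp Require Import all_classical all_reals.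
From mathcomp Require Import zify.

Import Order.TTheory GRing.Theory Num.Theory.
Local Open Scope classical_set_scope.
Local Open Scope ring_scope.

(** For fixed [x], property D of [E] and property C of [F] make the image of an
    interval operator [A] at [x] the full interval with midpoint
    [mid A x] and radius [rad A |x|].  A quantifier block thus becomes a game in
    [F]: the universal player shifts the running sum by at most [r'], the
    existential player by at most [r''], and the sum must finally vanish.  By
    induction on the number of blocks, starting from the innermost one, the
    existential player wins from [z] iff [z] and [- z] are at most
    [\sum r'' - \sum r'] and all proper partial sums of [r'' - r'] are
    nonnegative; the induction step is the
    Riesz decomposition, a consequence of property C. *)

(** * Symmetric order intervals and Riesz decomposition *)

Section OrderedVectBounds.
Context {R : realType} {V : ordVectType R}.
Implicit Types x y z r s : V.

(** Stands for [|z| <= r] in spaces without an absolute value. *)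
Definition vbounded r z : bool := - r <= z <= r.

Lemma levD2rE z x y : (x + z <= y + z) = (x <= y).
Proof. by apply/idP/idP => [/(levD2r (- z))|/levD2r//]; rewrite !addrK. Qed.

Lemma levD x y z t : x <= y -> z <= t -> x + z <= y + t.
Proof.
move=> xy zt; apply: (le_trans (levD2r z _ _ xy)).
by rewrite ![y + _]addrC levD2rE.
Qed.

Lemma vaddr_ge0 x y : 0 <= x -> 0 <= y -> 0 <= x + y.
Proof. by move=> x0 /(levD _ _ _ _ x0); rewrite addr0. Qed.

Lemma levN2 x y : (- x <= - y) = (y <= x).
Proof. by rewrite -(vsubr_ge0 y) -(vsubr_ge0 (- x)) opprK addrC. Qed.

Lemma levBrDr x y z : (x <= y - z) = (x + z <= y).
Proof. by rewrite -(levD2rE z) subrK. Qed.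

Lemma vhalfD x : 2%:R^-1 *: x + 2%:R^-1 *: x = x.
Proof. by rewrite -scalerDl -div1r -splitr scale1r. Qed.

Lemma vdouble_ge0 x : 0 <= x + x -> 0 <= x.
Proof.
move=> xx; rewrite -[x]vhalfD -scalerDr -(scaler0 V (2%:R^-1 : R)).
by apply: lev_wpZ2l => //; rewrite invr_ge0 ler0n.
Qed.

Lemma vboundedN r z : vbounded r (- z) = vbounded r z.
Proof. by rewrite /vbounded levN2 andbC -{1}[r]opprK levN2. Qed.

Lemma vboundedD r s y z :
  vbounded r y -> vbounded s z -> vbounded (r + s) (y + z).
Proof.
by move=> /andP[y1 y2] /andP[z1 z2]; rewrite /vbounded opprD !levD.
Qed.

Lemma vbounded_ge0 r z : vbounded r z -> 0 <= r.
Proof.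
by move=> /andP[h1 h2]; apply: vdouble_ge0; rewrite -{2}[r]opprK vsubr_ge0 (le_trans h1).
Qed.

Lemma vbounded0 z : vbounded 0 z = (z == 0).
Proof. by rewrite /vbounded oppr0 eq_le andbC. Qed.

Lemma vbounded_rad r : 0 <= r -> vbounded r r.
Proof.
by move=> r0; rewrite /vbounded lexx andbT (le_trans _ r0)// -oppr0 levN2.
Qed.

(** The extreme shift [r] yields the upper bound on [y], the extreme shift [- r] the lower one. *)
Lemma vboundedBr r s y :
  vbounded s (y + r) -> vbounded s (y - r) -> vbounded (s - r) y.
Proof.
move=> /andP[_ h1] /andP[h2 _]; apply/andP; split; last by rewrite levBrDr.
by rewrite opprB addrC -levBrDr.
Qed.

Lemma vbounded_subr r s y u :
  vbounded (s - r) y -> vbounded r u -> vbounded s (y + u).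
Proof. by move=> hy hu; have := vboundedD _ _ _ _ hy hu; rewrite subrK. Qed.

Lemma ivl_mid_add_rad (a : ivl V) : ivl_mid a + ivl_rad a = ivl_hi a.
Proof.
by rewrite /ivl_mid /ivl_rad -scalerDr addrACA addrN addr0 scalerDr vhalfD.
Qed.

Lemma ivl_mid_sub_rad (a : ivl V) : ivl_mid a - ivl_rad a = ivl_lo a.
Proof.
by rewrite /ivl_mid /ivl_rad -scalerBr opprB addrC addrA subrK scalerDr vhalfD.
Qed.

Lemma ivl_rad_ge0 (a : ivl V) : 0 <= ivl_rad a.
Proof.
by apply: vdouble_ge0; rewrite /ivl_rad vhalfD vsubr_ge0 ivl_le.
Qed.

Lemma ivl_setE (a : ivl V) z : ivl_set a z <-> vbounded (ivl_rad a) (z - ivl_mid a).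
Proof.
rewrite /ivl_set /vbounded /= -(levD2rE (ivl_mid a) (- _)) -(levD2rE (ivl_mid a) (z - _)).
by rewrite subrK ![_ + ivl_mid a]addrC ivl_mid_sub_rad ivl_mid_add_rad.
Qed.

(* [2 t - 1] for the multiplicator [t] sending [r + r] to [z + r]. *)
Lemma propertyC_signed r z : propertyC V -> vbounded r z ->
  exists2 s : {linear V -> V},
    (forall y, 0 <= y -> vbounded y (s y)) & s r = z.
Proof.
move=> hC hz; have r0 := vbounded_ge0 _ _ hz; case/andP: hz => h1 h2.
have zr0 : 0 <= z + r by rewrite -[r]opprK vsubr_ge0.
have [||| t [tm tE]] := hC (z + r) (r + r).
- exact: zr0.
- exact: vaddr_ge0.
- by rewrite levD2rE.
exists (t + t - (idfun : {linear V -> V})) => [y y0|].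
  rewrite linD linN linD /= /vbounded.
  have /andP[t0 t1] := tm y y0; apply/andP; split.
    by rewrite -{1}[- y]add0r levD2rE vaddr_ge0.
  by rewrite -[leRHS](addrK y) levD2rE levD.
by rewrite linD linN linD /= -linearD tE addrK.
Qed.

(** Riesz decomposition: one linear map sends [r + s] to [z], and its values at [r] and at [s] are
    the two pieces. *)
Lemma vbounded_split r s z : propertyC V -> 0 <= r -> 0 <= s ->
  vbounded (r + s) z ->
  exists y1 y2, [/\ z = y1 + y2, vbounded r y1 & vbounded s y2].
Proof.
move=> hC r0 s0 /(propertyC_signed _ _ hC)[f fb fE].
by exists (f r), (f s); split; rewrite -?linearD ?fE; auto.
Qed.

End OrderedVectBounds.

(** * Positive parts, absolute value and property D *)

Section VectLatticeParts.
Context {R : realType} {E : vectLatticeType R}.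
Implicit Types x y z : E.

Definition vpos x : E := vjoin x 0.

Lemma vjoin_lel x y : x <= vjoin x y.
Proof. by have := lev_join x y (vjoin x y); rewrite lexx => /esym/andP[]. Qed.

Lemma vjoin_ler x y : y <= vjoin x y.
Proof. by have := lev_join x y (vjoin x y); rewrite lexx => /esym/andP[]. Qed.

Lemma vmeet_lel x y : vmeet x y <= x.
Proof. by have := lev_meet (vmeet x y) x y; rewrite lexx => /esym/andP[]. Qed.

Lemma vmeet_ler x y : vmeet x y <= y.
Proof. by have := lev_meet (vmeet x y) x y; rewrite lexx => /esym/andP[]. Qed.

Lemma vjoinDr z x y : vjoin (x + z) (y + z) = vjoin x y + z.
Proof.
apply/eqP; rewrite eq_le lev_join !levD2rE vjoin_lel vjoin_ler /=.
by rewrite -levBrDr lev_join !levBrDr vjoin_lel vjoin_ler.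
Qed.

Lemma vpos_ge0 x : 0 <= vpos x. Proof. exact: vjoin_ler. Qed.

Lemma vposN x : vpos (- x) = vpos x - x.
Proof.
rewrite /vpos -vjoinDr addrN add0r.
by apply/eqP; rewrite eq_le !lev_join !vjoin_lel !vjoin_ler.
Qed.

Lemma vposBN x : x = vpos x - vpos (- x).
Proof. by rewrite vposN subKr. Qed.

Lemma vabsE x : vabs x = vpos x + vpos (- x).
Proof.
rewrite vposN addrA /vabs -[x in vjoin x](addrK x) -[X in vjoin _ X]add0r vjoinDr.
(* Translated by [x], the claim is that the join of [x + x] and [0] equals [vpos x + vpos x]. For
   the harder inequality, half of that join dominates both [x] and [0]. *)
congr (_ - x); apply/eqP; rewrite eq_le lev_join !levD ?vjoin_lel//=.
  rewrite vaddr_ge0 ?vjoin_ler//=.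
  set j := vjoin _ _.
  suff : vpos x <= 2%:R^-1 *: j by move=> h; rewrite -[j]vhalfD levD.
  rewrite lev_join; apply/andP; split.
    by rewrite -(vhalfD x) -scalerDr lev_wpZ2l ?invr_ge0 ?ler0n ?vjoin_lel.
  by rewrite -(scaler0 E (2%:R^-1 : R)) lev_wpZ2l ?invr_ge0 ?ler0n ?vjoin_ler.
Qed.

(** If [m] lies below both parts, then [vpos x - m] still dominates [x] and [0], hence [vpos x], so
    [m <= 0]. *)
Lemma vpos_meet x : vmeet (vpos x) (vpos (- x)) = 0.
Proof.
set m := vmeet _ _; apply/eqP; rewrite eq_le lev_meet !vpos_ge0 andbT.
have m1 : m <= vpos x := vmeet_lel _ _.
have m2 : m <= vpos x - x by rewrite -vposN vmeet_ler.
have : vpos x <= vpos x - m.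
  by rewrite {1}/vpos lev_join vsubr_ge0 m1 levBrDr addrC -levBrDr m2.
by rewrite levBrDr -[leRHS]add0r addrC levD2rE andbT.
Qed.

(** Take [f = 2 t - 1], where [t] fixes [vpos x] and kills [vpos (- x)]: [f] flips the sign of the
    negative part. The splitting [y = t y + (y - t y)] is what later bounds operators composed with
    [f]. *)
Lemma propertyD_signed x : propertyD E ->
  exists2 f : {linear E -> E},
    (forall y, 0 <= y -> exists p q, [/\ 0 <= p, 0 <= q, y = p + q & f y = p - q])
    & f x = vabs x.
Proof.
move=> hD; have [||| t [tm tp tn]] := hD (vpos x) (vpos (- x)).
- exact: vpos_ge0.
- exact: vpos_ge0.
- exact: vpos_meet.
exists (t + t - (idfun : {linear E -> E})) => [y y0|].
  have /andP[t0 t1] := tm y y0; exists (t y), (y - t y).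
  by rewrite vsubr_ge0 subrKC linD linN linD /= opprB addrA.
by rewrite linD linN linD /= {1 2 3}(vposBN x) linearB tp tn subr0 vabsE opprB addrAC addrA subrK.
Qed.

End VectLatticeParts.

(** * Images of interval operators at a point *)

Section IntervalOperatorImage.
Context {R : realType} {E : vectLatticeType R} {F : ordVectType R}.
Implicit Types (a : ivlop E F) (b : ivl F) (x : E).

Lemma vbounded_lin (D B : {linear E -> F}) x :
  vbounded D B -> vbounded (D (vabs x)) (B x).
Proof.
move=> /andP[/lin_leP h1 /lin_leP h2].
have hp y : 0 <= y -> vbounded (D y) (B y).
  by move=> y0; rewrite /vbounded h2// andbT -linN h1.
rewrite vabsE {3}(vposBN x) linearD linearB vboundedD ?vboundedN//.
  by apply: hp; exact: vpos_ge0.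
by apply: hp; exact: vpos_ge0.
Qed.

Lemma ivlop_image (hE : propertyD E) (hF : propertyC F) a x (y : F) :
  (exists2 A, ivl_set a A & A x = y) <->
  vbounded (ivl_rad a (vabs x)) (y - ivl_mid a x).
Proof.
split=> [[A /ivl_setE aA <-]|hy].
  by have := vbounded_lin _ _ x aA; rewrite linD linN.
have [s sb sE] := propertyC_signed _ _ hF hy.
have [f fb fE] := propertyD_signed x hE.
(* The deviation from the midpoint acts on [x] as follows: [f] sends [x] to [vabs x], the radius is
   applied, and [s] sends the result to [y - ivl_mid a x]. *)
exists (ivl_mid a + (s \o ivl_rad a \o f : {linear E -> F})); last first.
  by rewrite linD /= fE sE subrKC.
apply/ivl_setE; rewrite addrC addKr.
(* With [z = p + q] and [f z = p - q], the images of [p] and [q] are bounded by their radii, which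
   add up to the radius at [z]. *)
have hb z : 0 <= z -> vbounded (ivl_rad a z) (s (ivl_rad a (f z))).
  move=> z0; have [p [q [p0 q0 -> ->]]] := fb z z0.
  have /lin_leP r0 := ivl_rad_ge0 a.
  rewrite linearB linearD [s _]linearB vboundedD ?vboundedN//.
    by apply: sb; rewrite (le_trans _ (r0 p p0)).
  by apply: sb; rewrite (le_trans _ (r0 q q0)).
apply/andP; split; apply/lin_leP => z z0; have /andP[] := hb z z0 => //.
Qed.

Lemma ivlop_block_image (hE : propertyD E) (hF : propertyC F) a b x (w : F) :
  (exists2 A, ivl_set a A & exists2 c, ivl_set b c & w = A x - c) <->
  vbounded (ivl_rad a (vabs x) + ivl_rad b) (w - (ivl_mid a x - ivl_mid b)).
Proof.
split=> [[A aA [c /ivl_setE bc ->]]|].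
  have -> : A x - c - (ivl_mid a x - ivl_mid b) =
            (A x - ivl_mid a x) - (c - ivl_mid b).
    by rewrite !opprB [ivl_mid b - _]addrC addrACA [- c + _]addrC.
  by rewrite vboundedD ?vboundedN// -ivlop_image//; exists A.
have /lin_leP ra0 := ivl_rad_ge0 a.
have rax0 : 0 <= ivl_rad a (vabs x) by rewrite ra0// vabsE vaddr_ge0 ?vpos_ge0.
(* The deviation of [w] is shared out: [y1] is realized by the operator, [y2] by the right-hand
   side. *)
case/(vbounded_split _ _ _ hF rax0 (ivl_rad_ge0 b)) => y1 [y2 [wE h1 h2]].
have : vbounded (ivl_rad a (vabs x)) (y1 + ivl_mid a x - ivl_mid a x).
  by rewrite addrK.
rewrite -ivlop_image// => -[A aA AE].
exists A => //; exists (ivl_mid b - y2).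
  by apply/ivl_setE; rewrite addrC addKr vboundedN.
by rewrite AE -[w](subrK (ivl_mid a x - ivl_mid b)) wE opprB addrACA addrC addrCA addrA.
Qed.

End IntervalOperatorImage.

(** * One round of the game *)

Section AlternatingGame.
Context {R : realType} {F : ordVectType R}.
Implicit Types (c y z r d : F).

(** Here [d] is the bound the remaining inner rounds can absorb. Necessity comes from the moves
    [u = r'] and [u = - r'], and any nonempty symmetric interval forces [0 <= d]; sufficiency is
    Riesz decomposition. *)
Lemma alternating_step (hF : propertyC F) r' r'' d y : 0 <= r' -> 0 <= r'' ->
  (forall u, vbounded r' u -> exists2 v, vbounded r'' v & vbounded d (y + u + v))
  <-> vbounded (d + (r'' - r')) y /\ 0 <= d.
Proof.
move=> r'0 r''0; split=> [H|[hy d0] u hu].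
  have hs u : vbounded r' u -> vbounded (d + r'') (y + u).
    move=> /H[v hv hd]; rewrite -(addrK v (y + u)).
    by rewrite vboundedD// vboundedN.
  split; last by have [v _ /vbounded_ge0] := H _ (vbounded_rad _ r'0).
  by rewrite addrA vboundedBr// hs// ?vboundedN vbounded_rad.
have : vbounded (d + r'') (y + u) by apply: vbounded_subr hu; rewrite -addrA.
case/(vbounded_split _ _ _ hF d0 r''0) => v1 [v2 [-> h1 h2]].
(* The reply cancels the part [v2] of size [r''] and leaves [v1], bounded by [d]. *)
by exists (- v2); rewrite ?vboundedN// addrK.
Qed.

Lemma alternating_step_centered (hF : propertyC F) r' r'' c' c'' d y :
  0 <= r' -> 0 <= r'' ->
  (forall u, vbounded r' (u - c') ->
     exists2 v, vbounded r'' (v - c'') & vbounded d (y + (u + v)))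
  <-> vbounded (d + (r'' - r')) (y + (c' + c'')) /\ 0 <= d.
Proof.
move=> r'0 r''0; rewrite -alternating_step//.
have E u v : y + (u + v) = y + (c' + c'') + (u - c') + (v - c'').
  by rewrite -[RHS]addrA [u - c' + _]addrACA -opprD -[RHS]addrA subrKC.
split=> H u hu.
  have [|v hv hd] := H (u + c'); first by rewrite addrK.
  by exists (v - c'') => //; rewrite -[u](addrK c') -E.
have [v hv hd] := H _ hu.
by exists (v + c''); rewrite ?addrK// E addrK.
Qed.

End AlternatingGame.

(** * Peeling off the outermost block *)

Lemma sum_ord_lift_max (V : nmodType) n (f : 'I_n.+1 -> V) :
  \sum_(i < n.+1) f i = \sum_(i < n) f (lift ord_max i) + f ord_max.
Proof.
rewrite big_ord_recr; congr (_ + _); apply: eq_bigr => i _.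
by congr f; apply: val_inj; exact/esym/lift_max.
Qed.

Lemma ord_snoc_lift T n (f : 'I_n -> T) t i : ord_snoc f t (lift ord_max i) = f i.
Proof. by rewrite /ord_snoc liftK. Qed.

Lemma ord_snoc_max T n (f : 'I_n -> T) t : ord_snoc f t ord_max = t.
Proof. by rewrite /ord_snoc unlift_none. Qed.

Lemma eq_quant_blocks (R : realType) (E : vectLatticeType R) (F : ordVectType R) n
    (AA AE : 'I_n -> ivlop E F) (bA bE : 'I_n -> ivl F) P Q :
  (forall A' A'' b' b'', P A' A'' b' b'' <-> Q A' A'' b' b'') ->
  quant_blocks AA AE bA bE P <-> quant_blocks AA AE bA bE Q.
Proof.
move=> PQ; suff -> : P = Q by [].
by do 4 apply/funext => ?; apply/propext.
Qed.

(** * Induction on the number of blocks *)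

Section QuantifiedSystem.
Context {R : realType} {E : vectLatticeType R} {F : ordVectType R}.
Variables (hE : propertyD E) (hF : propertyC F) (x : E).

Let rad (a : ivlop E F) (b : ivl F) := ivl_rad a (vabs x) + ivl_rad b.
Let mid (a : ivlop E F) (b : ivl F) := ivl_mid a x - ivl_mid b.

Let rad_ge0 a b : 0 <= rad a b.
Proof.
have /lin_leP ra0 := ivl_rad_ge0 a.
by rewrite /rad vaddr_ge0 ?ivl_rad_ge0// ra0// vabsE vaddr_ge0 ?vpos_ge0.
Qed.

(* The offset [z] stands for the contribution of the outer blocks. *)
Lemma quant_blocks_offset n (AA AE : 'I_n -> ivlop E F) (bA bE : 'I_n -> ivl F) z :
  quant_blocks AA AE bA bE (fun A' A'' b' b'' =>
    z + \sum_(s < n) ((A' s + A'' s) x - (b' s + b'' s)) = 0) <->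
  vbounded (\sum_(i < n) (rad (AE i) (bE i) - rad (AA i) (bA i)))
    (z + \sum_(i < n) (mid (AA i) (bA i) + mid (AE i) (bE i))) /\
  forall l, (l < n)%N ->
    0 <= \sum_(i < n | (i < l)%N) (rad (AE i) (bE i) - rad (AA i) (bA i)).
Proof.
elim: n => [|n IH] in AA AE bA bE z *.
  by rewrite /= !big_ord0 vbounded0; split=> [->|[/eqP]].
set c' := mid (AA ord_max) (bA ord_max); set c'' := mid (AE ord_max) (bE ord_max).
set r' := rad (AA ord_max) (bA ord_max); set r'' := rad (AE ord_max) (bE ord_max).
(* [L] restricts a tuple to the inner [n] blocks; [d], [S] and [C] are their total radius
   difference, midpoint sum and partial-sum conditions. *)
pose L T (f : 'I_n.+1 -> T) i := f (lift ord_max i).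
pose d := \sum_(i < n) (rad (L _ AE i) (L _ bE i) - rad (L _ AA i) (L _ bA i)).
pose S := \sum_(i < n) (mid (L _ AA i) (L _ bA i) + mid (L _ AE i) (L _ bE i)).
pose C := forall l, (l < n)%N ->
  0 <= \sum_(i < n | (i < l)%N) (rad (L _ AE i) (L _ bE i) - rad (L _ AA i) (L _ bA i)).
(* The outermost block becomes a pair of moves [u], [v] in [F]. [C] depends on neither, but the
   induction hypothesis delivers it under the quantifiers. *)
transitivity (forall u, vbounded r' (u - c') ->
   exists2 v, vbounded r'' (v - c'') & vbounded d (z + S + (u + v)) /\ C).
  (* This is the induction hypothesis at the offset [z] enlarged by the outermost block's
     contribution. *)
  have key A' A'' b' b'' :
    quant_blocks (L _ AA) (L _ AE) (L _ bA) (L _ bE) (fun As' As'' bs' bs'' =>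
      z + \sum_(s < n.+1) ((ord_snoc As' A' s + ord_snoc As'' A'' s) x
         - (ord_snoc bs' b' s + ord_snoc bs'' b'' s)) = 0) <->
    vbounded d (z + S + (A' x - b' + (A'' x - b''))) /\ C.
    rewrite addrAC -IH; apply: eq_quant_blocks => As' As'' bs' bs''.
    rewrite sum_ord_lift_max !ord_snoc_max.
    under eq_bigr do rewrite !ord_snoc_lift.
    rewrite linD opprD [_ + _ + (- b' - b'')]addrACA [\sum_(i < n) _ + _]addrC [z + (_ + \sum_(i < n) _)]addrA.
    exact: iff_refl.
  split=> H.
    move=> u /ivlop_block_image[]// A' aA' [b' ab' ->].
    have [A'' aA'' [b'' ab'' /key]] := H A' aA' b' ab'.
    by exists (A'' x - b'') => //; apply/ivlop_block_image => //; exists A'' => //; exists b''.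
  move=> A' aA' b' ab'.
  have [|v] := H (A' x - b').
    by apply/ivlop_block_image => //; exists A' => //; exists b'.
  move=> /ivlop_block_image[]// A'' aA'' [b'' ab'' ->] /key HH.
  by exists A'' => //; exists b''.
have -> : \sum_(i < n.+1) (rad (AE i) (bE i) - rad (AA i) (bA i)) = d + (r'' - r').
  by rewrite sum_ord_lift_max.
have -> : z + \sum_(i < n.+1) (mid (AA i) (bA i) + mid (AE i) (bE i)) =
    z + S + (c' + c'') by rewrite sum_ord_lift_max addrA.
(* Partial sums with [l < n] are the conditions [C]; the new one, [l = n], is the full inner sum
   [d]. *)
have CE : (forall l, (l < n.+1)%N ->
    0 <= \sum_(i < n.+1 | (i < l)%N) (rad (AE i) (bE i) - rad (AA i) (bA i)))
    <-> C /\ 0 <= d.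
  have sumE l : (l <= n)%N ->
      \sum_(i < n.+1 | (i < l)%N) (rad (AE i) (bE i) - rad (AA i) (bA i)) =
      \sum_(i < n | (i < l)%N) (rad (L _ AE i) (L _ bE i) - rad (L _ AA i) (L _ bA i)).
    move=> ln; rewrite big_mkcond sum_ord_lift_max (leq_gtF ln : ord_max < l = false)%N addr0 [RHS]big_mkcond.
    by apply: eq_bigr => i _; rewrite lift_max.
  have dE : d = \sum_(i < n | (i < n)%N)
      (rad (L _ AE i) (L _ bE i) - rad (L _ AA i) (L _ bA i)).
    by apply: eq_bigl => i; rewrite ltn_ord.
  split=> [H|[HC hd] l].
    split=> [l ln|]; first by have := H l (leqW ln); rewrite sumE// ltnW.
    by have := H n (ltnSn n); rewrite sumE// -dE.
  rewrite ltnS leq_eqVlt => /orP[/eqP->|ln]; first by rewrite sumE// -dE.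
  by rewrite sumE ?(ltnW ln)//; exact: HC.
rewrite CE; have [step1 step2] :=
  alternating_step_centered hF r' r'' c' c'' d (z + S) (rad_ge0 _ _) (rad_ge0 _ _).
split=> [H|[hb [HC hd]] u hu].
  have [|hb hd] := step1.
    by move=> u /H[v hv [hd _]]; exists v.
  (* Extracting [C] takes some legal universal move; the extreme one serves. *)
  have [|v _ [_ HC]] := H (r' + c'); first by rewrite addrK vbounded_rad// rad_ge0.
  by [].
by have [v hv hd'] := step2 (conj hb hd) u hu; exists v.
Qed.

End QuantifiedSystem.

Theorem mainTheorem2 (R : realType) (k : nat) (hk : (1 <= k)%N)
    (E : vectLatticeType R) (hE : propertyD E)
    (F : ordVectType R) (hF : propertyC F)
    (AA AE : 'I_k -> ivlop E F) (bA bE : 'I_k -> ivl F) (x : E) :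
  Xi_iq AA AE bA bE x <->
  ((- (\sum_(i < k) (ivl_rad (AE i) (vabs x) + ivl_rad (bE i)))
      + \sum_(i < k) (ivl_rad (AA i) (vabs x) + ivl_rad (bA i))
    <= \sum_(i < k) ((ivl_mid (AA i) + ivl_mid (AE i)) x
                      - (ivl_mid (bA i) + ivl_mid (bE i)))
    <= \sum_(i < k) (ivl_rad (AE i) (vabs x) + ivl_rad (bE i))
      - \sum_(i < k) (ivl_rad (AA i) (vabs x) + ivl_rad (bA i)))
   /\
   (forall l : nat, (1 <= l <= k - 1)%N ->
      \sum_(i < k | (i < l)%N) (ivl_rad (AA i) (vabs x) + ivl_rad (bA i))
      <= \sum_(i < k | (i < l)%N) (ivl_rad (AE i) (vabs x) + ivl_rad (bE i)))).
Proof.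
have rBE P : \sum_(i < k | P i) (ivl_rad (AE i) (vabs x) + ivl_rad (bE i))
    - \sum_(i < k | P i) (ivl_rad (AA i) (vabs x) + ivl_rad (bA i)) =
  \sum_(i < k | P i) (ivl_rad (AE i) (vabs x) + ivl_rad (bE i)
    - (ivl_rad (AA i) (vabs x) + ivl_rad (bA i))) by rewrite sumrB.
(* The equation is moved to one side, giving the game with offset [0]. *)
have -> : Xi_iq AA AE bA bE x <-> quant_blocks AA AE bA bE (fun A' A'' b' b'' =>
    0 + \sum_(s < k) ((A' s + A'' s) x - (b' s + b'' s)) = 0).
  apply: eq_quant_blocks => A' A'' b' b''; rewrite add0r sumrB.
  by split=> [->|/eqP]; rewrite ?subrr// subr_eq0 => /eqP.
rewrite (quant_blocks_offset hE hF) add0r -rBE /vbounded opprB [X in X <= _ <= _]addrC.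
under [X in _ <= X <= _]eq_bigr do rewrite addrACA -opprD -linD.
split=> -[hb H]; split=> // l hl.
  by rewrite -vsubr_ge0 rBE; apply: H; lia.
(* The game conditions include [l = 0], outside the stated range; there the sum is empty. *)
case: l hl => [|l] hl; first by rewrite big_pred0_eq.
by rewrite -rBE vsubr_ge0 H//; lia.
Qed.
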